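(* Let $\mathfrak{H}$ and $\mathfrak{K}_n$, $n\in\mathbb{N}$, be Hilbert spaces and let $T_n\in\mathbf{L}(\mathfrak{H},\mathfrak{K}_n)$ be a sequence of linear operators which satisfy $$T_n\prec_c T_m,\quad m\le n.$$ Then there exists a linear operator $T\in\mathbf{L}(\mathfrak{H},\mathfrak{K})$, where $\mathfrak{K}$ is a Hilbert space, such that $$\operatorname{dom}T=\bigcup_{n\in\mathbb{N}}\operatorname{dom}T_n,$$ and which satisfies, for all $n\in\mathbb{N}$, $$T\prec_c T_n\quad\text{and}\quad\|T_n\varphi\|\searrow\|T\varphi\|\ \ (n\to\infty),\quad\varphi\in\operatorname{dom}T.$$
   Context: $\mathbf{L}(\mathfrak{H},\mathfrak{K})$ denotes the class of all linear relations from the Hilbert space $\mathfrak{H}$ to the Hilbert space $\mathfrak{K}$, i.e. all linear subspaces of $\mathfrak{H}\times\mathfrak{K}$; a linear operator is a linear relation $T$ with $\{f':\{0,f'\}\in T\}=\{0\}$. Operators are defined on a linear subspace which need not be dense and need not be bounded. For linear operators $A\in\mathbf{L}(\mathfrak{H},\mathfrak{H}_A)$ and $B\in\mathbf{L}(\mathfrak{H},\mathfrak{H}_B)$, $A\prec_c B$ means that there is a contraction $C\in\mathbf{B}(\mathfrak{H}_B,\mathfrak{H}_A)$ (bounded, everywhere defined) with $CB\subset A$; equivalently $\operatorname{dom}B\subset\operatorname{dom}A$ and $\|Af\|\le\|Bf\|$ for all $f\in\operatorname{dom}B$. Under the hypothesis the domains $\operatorname{dom}T_n$ are nondecreasing in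 $n$, so each $\varphi\in\bigcup_n\operatorname{dom}T_n$ lies in $\operatorname{dom}T_n$ for all sufficiently large $n$; $\|T_n\varphi\|\searrow\|T\varphi\|$ denotes nonincreasing convergence along those $n$. *)

(* Defs.v *)
From HB Require Import structures.
From mathcomp Require Import all_boot all_order all_algebra.
From mathcomp Require Import sesquilinear.
From mathcomp Require Import complex.
From mathcomp Require Import all_classical all_reals all_analysis.

Set Implicit Arguments.
Unset Strict Implicit.
Unset Printing Implicit Defensive.

Import Order.TTheory GRing.Theory Num.Theory.
Import numFieldNormedType.Exports.

Local Open Scope classical_set_scope.
Local Open Scope ring_scope.

(* Complex Hilbert spaces.  The inner product is linear in its first argument. *)
HB.mixin Record CompleteNormedModule_isHilbert (R : realType) V
    & CompleteNormedModule R[i] V := {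
  inner : {dot V for (@Num.conj R[i])};
  norm_inner : forall x : V, `|x| ^+ 2 = inner x x
}.

#[short(type="hilbertType")]
HB.structure Definition Hilbert (R : realType) :=
  {V of CompleteNormedModule R[i] V & CompleteNormedModule_isHilbert R V}.

(* The norm of an R[i]-module takes values in R[i]; hnorm is the same norm,
   as a real number. *)
Definition hnorm (R : realType) (H : hilbertType R) (x : H) : R :=
  complex.Re `|x|.

Section Relations.
Variable R : realType.
Implicit Types H K : hilbertType R.

(* T belongs to L(H, K). *)
Definition linear_relation H K (T : set (H * K)) : Prop :=
  T 0 /\ forall (a : R[i]) (u v : H * K), T u -> T v -> T (a *: u + v).

Definition mulpart H K (T : set (H * K)) : set K := [set f' | T (0, f')].

Definition linear_operator H K (T : set (H * K)) : Prop :=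
  linear_relation T /\ mulpart T = [set 0].

Definition dom H K (T : set (H * K)) : set H := [set f | exists f', T (f, f')].

(* The value T f when T is an operator and f is in dom T (0 if f is not). *)
Definition value H K (T : set (H * K)) (f : H) : K :=
  xget 0 [set f' | T (f, f')].

Definition contractive H K (C : {linear H -> K}) : Prop :=
  forall x, `|C x| <= `|x|.

(* The product relation C B. *)
Definition lcomp H K1 K2 (C : K1 -> K2) (B : set (H * K1)) : set (H * K2) :=
  [set p | exists2 h, B (p.1, h) & p.2 = C h].

Definition prec_c H K1 K2 (A : set (H * K1)) (B : set (H * K2)) : Prop :=
  exists C : {linear K2 -> K1}, contractive C /\ lcomp C B `<=` A.

(* ||T_n f|| decreases to ||T f||, where the monotonicity is required only
   along those n with f in dom T_n.  The limit may be taken over all n since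
   the relation is used for f in dom T_n for all large n. *)
Definition norm_decreases_to H (K_ : nat -> hilbertType R) K
    (T_ : forall n, set (H * K_ n)) (T : set (H * K)) (f : H) : Prop :=
  (forall m n, (m <= n)%N -> dom (T_ m) f -> dom (T_ n) f ->
     hnorm (value (T_ n) f) <= hnorm (value (T_ m) f)) /\
  (fun n => hnorm (value (T_ n) f)) @ \oo --> hnorm (value T f).

End Relations.

(* Main.v *)
Require Import Defs.
From HB Require Import structures.
From mathcomp Require Import all_boot all_order all_algebra.
From mathcomp Require Import sesquilinear complex ring_quotient generic_quotient.
From mathcomp Require Import all_classical all_reals all_analysis.
From mathcomp Require Import ring lra.

Import Order.TTheory GRing.Theory Num.Theory.
Import numFieldNormedType.Exports.

Local Open Scope classical_set_scope.
Local Open Scope quotient_scope.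
Local Open Scope ring_scope.

(** The space K is the ultraproduct of the spaces K_n along an ultrafilter U on
    the natural numbers that contains every cofinal segment: bounded sequences
    (x_n) with x_n in K_n, the semi-inner product lim_U <x_n, y_n>, and the
    quotient by the sequences of seminorm zero.

    Choose linear contractions C_(m,n) : K_m -> K_n with C_(m,n) T_m contained
    in T_n for m <= n.  An element h of K_m has the bounded orbit
    (C_(m,n) h)_n, whose class in K is written J_m h; J_m is a linear
    contraction because every C_(m,n) is.  Let T send f to J_m h whenever
    (f, h) is in T_m.  This does not depend on m: if (f, g) is in T_m and (f, h)
    in T_n, then for k >= m, n both C_(m,k) g and C_(n,k) h are the value of the
    operator T_k at f, so that the two orbits agree eventually and have the same
    class.  Hence T is an operator with domain the union of the domains, J_n T_n
    is contained in T by construction, and || T f || is the limit along U of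
    || T_n f ||.  That sequence is eventually nonincreasing, so it converges, and
    its limit must be the limit along U.

    The ultraproduct is a Hilbert space for two separate reasons.  A semi-inner
    product that is complete in the sense of [semi_complete] has a Hilbert space
    as its quotient by the null vectors ([semi_inner_Hilbert]); and the
    semi-inner product of the ultraproduct is complete by a diagonal argument
    ([ultra_inner_complete]), which uses the countable incompleteness of U rather
    than the completeness of the K_n.  Compared with completing the pre-Hilbert
    space of the values of T, this makes each J_n everywhere defined from the
    start, with no extension by continuity. *)

(** * Norms with values in the complex numbers *)

Section ComplexNorm.
Context {R : realType} {V : normedModType R[i]}.
Implicit Type x : V.

Lemma normr_Re x : `|x| = (complex.Re `|x|)%:C%C.
Proof. by rewrite RRe_real. Qed.

Lemma Re_norm_ge0 x : 0 <= complex.Re `|x|.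
Proof. by rewrite -ler0c -normr_Re. Qed.

Lemma Re_normX2 x : complex.Re (`|x| ^+ 2) = complex.Re `|x| ^+ 2.
Proof. by rewrite [in LHS]normr_Re -rmorphXn. Qed.

End ComplexNorm.

(** * The Hilbert space of a complete semi-inner product *)

Section SemiInnerProduct.
Context {R : realType} {V : lmodType R[i]} (s : V -> V -> R[i]).

Definition semi_inner :=
  [/\ forall a x y z, s (a *: x + y) z = a * s x z + s y z,
      forall x y, s x y = (s y x)^*
    & forall x, 0 <= s x x].

(** Completeness of the seminorm, stated for sequences whose Cauchy condition
    carries an explicit modulus d.  As the limit is reached with the same modulus
    and d is arbitrary, no rate of decay has to be mentioned. *)
Definition semi_complete := forall (d : nat -> R) (x : nat -> V),
  (forall k l, (k <= l)%N -> complex.Re (s (x k - x l) (x k - x l)) < d k) ->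
  exists z, forall k, complex.Re (s (x k - z) (x k - z)) <= d k.

Hypothesis sP : semi_inner.

Let slin a x y z : s (a *: x + y) z = a * s x z + s y z.
Proof. by case: sP => + _ _; apply. Qed.
Let sC x y : s x y = (s y x)^*.
Proof. by case: sP => _ + _; apply. Qed.
Let s_ge0 x : 0 <= s x x.
Proof. by case: sP => _ _ +; apply. Qed.

Lemma semi_innerDl x y z : s (x + y) z = s x z + s y z.
Proof. by rewrite -[x]scale1r slin scale1r mul1r. Qed.

Lemma semi_inner0l z : s 0 z = 0.
Proof. by apply: (addrI (s 0 z)); rewrite -semi_innerDl !addr0. Qed.

Lemma semi_innerZl a x z : s (a *: x) z = a * s x z.
Proof. by rewrite -[a *: x]addr0 slin semi_inner0l addr0. Qed.

Lemma semi_innerNl x z : s (- x) z = - s x z.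
Proof. by rewrite -scaleN1r semi_innerZl mulN1r. Qed.

Lemma semi_innerDr x y z : s z (x + y) = s z x + s z y.
Proof. by rewrite sC semi_innerDl rmorphD /= -!sC. Qed.

Lemma semi_innerZr a x z : s z (a *: x) = a^* * s z x.
Proof. by rewrite sC semi_innerZl rmorphM /= -sC. Qed.

Lemma semi_innerNr x z : s z (- x) = - s z x.
Proof. by rewrite sC semi_innerNl rmorphN /= -sC. Qed.

(** The quadratic form is nonnegative at b x - t <x, y> y for all real b and t.
    If <y, y> > 0 then b = <y, y>, t = 1 gives the inequality.  If <y, y> = 0 the
    form with b = 1 is affine in t with slope -2 |<x, y>|^2, so <x, y> = 0. *)
Lemma semi_CauchySchwarz x y : `|s x y| ^+ 2 <= s x x * s y y.
Proof.
have expand (b t : R[i]) : b \is Num.real -> t \is Num.real ->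
    s (b *: x - (t * s x y) *: y) (b *: x - (t * s x y) *: y) =
    b ^+ 2 * s x x - 2 * b * t * `|s x y| ^+ 2 + t ^+ 2 * `|s x y| ^+ 2 * s y y.
  move=> /CrealP br /CrealP tr.
  rewrite semi_innerDl !semi_innerDr !semi_innerNl !semi_innerNr.
  rewrite !semi_innerZl !semi_innerZr normCK rmorphM /= br tr (sC y x).
  by ring.
have [y0|yN0] := eqVneq (s y y) 0; last first.
  have y_gt0 : 0 < s y y by rewrite lt_def yN0 s_ge0.
  have := s_ge0 (s y y *: x - (1 * s x y) *: y).
  rewrite expand ?ger0_real// => h.
  rewrite -subr_ge0 -(pmulr_rge0 _ y_gt0); apply: le_trans h _.
  by rewrite le_eqVlt; apply/orP; left; apply/eqP; ring.
rewrite y0 mulr0.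
have [->|cN0] := eqVneq (s x y) 0; first by rewrite normr0 expr0n.
have c_gt0 : 0 < `|s x y| ^+ 2 by rewrite exprn_gt0 ?normr_gt0.
(* At this t the affine function takes the value -1. *)
pose t := (s x x + 1) / (2 * `|s x y| ^+ 2).
have t_ge0 : 0 <= t.
  by rewrite divr_ge0 ?addr_ge0 ?mulr_ge0 ?ler01 ?ler0n// ltW.
have := s_ge0 (1 *: x - (t * s x y) *: y).
rewrite expand ?ger0_real// y0 mulr0 addr0 expr1n mul1r mulr1.
have -> : s x x - 2 * t * `|s x y| ^+ 2 = -1.
  by rewrite /t; move: (_ ^+ 2) c_gt0 => N N0; field; rewrite gt_eqF.
by move=> /le_lt_trans - /(_ _ (ltrN10 _)); rewrite ltxx.
Qed.

Definition null_pred : {pred V} := [pred x | s x x == 0].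

Lemma semi_inner_null x y : x \in null_pred -> s x y = 0.
Proof.
rewrite inE => /eqP x0; have := semi_CauchySchwarz x y.
by rewrite x0 mul0r real_exprn_even_le0 //= normr_eq0 => /eqP.
Qed.

Lemma null_pred_zmod_closed : zmod_closed null_pred.
Proof.
split=> [|x y x0 y0]; first by rewrite inE semi_inner0l.
by rewrite inE semi_innerDl semi_innerNl !semi_inner_null// subrr.
Qed.

HB.instance Definition _ :=
  GRing.isZmodClosed.Build V null_pred null_pred_zmod_closed.

Definition sep_quot : Type := (Quotient.quot null_pred).
HB.instance Definition _ := GRing.Zmodule.on sep_quot.

Definition sep_pi : V -> sep_quot := \pi_(Quotient.quot null_pred).

Lemma sep_piP (q : sep_quot) : exists x, q = sep_pi x.
Proof. by exists (repr q); rewrite /sep_pi reprK. Qed.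

Lemma sep_pi_eq x y : sep_pi x = sep_pi y <-> x - y \in null_pred.
Proof. by rewrite Quotient.idealrBE; split=> [/eqP|/eqP]. Qed.

Lemma sep_pi_zmod : zmod_morphism sep_pi.
Proof. by move=> x y; rewrite /sep_pi !piE. Qed.
HB.instance Definition _ :=
  GRing.isZmodMorphism.Build V sep_quot sep_pi sep_pi_zmod.

Lemma null_predZ a x : x \in null_pred -> a *: x \in null_pred.
Proof. by move=> x0; rewrite inE semi_innerZl semi_inner_null ?mulr0. Qed.

Definition sep_scale a (q : sep_quot) : sep_quot :=
  sep_pi (a *: repr (q : Quotient.quot null_pred)).

Lemma sep_scaleE a x : sep_scale a (sep_pi x) = sep_pi (a *: x).
Proof.
apply/sep_pi_eq; rewrite -scalerBr; apply: null_predZ.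
by apply/sep_pi_eq; rewrite /sep_pi reprK.
Qed.

Lemma sep_scaleA a b q : sep_scale a (sep_scale b q) = sep_scale (a * b) q.
Proof. by have [x ->] := sep_piP q; rewrite !sep_scaleE scalerA. Qed.

Lemma sep_scale1 : left_id 1 sep_scale.
Proof. by move=> q; have [x ->] := sep_piP q; rewrite sep_scaleE scale1r. Qed.

Lemma sep_scaleDr : right_distributive sep_scale +%R.
Proof.
move=> a q r; have [x ->] := sep_piP q; have [y ->] := sep_piP r.
by rewrite -raddfD !sep_scaleE scalerDr raddfD.
Qed.

Lemma sep_scaleDl q : {morph sep_scale^~ q : a b / a + b}.
Proof.
by move=> a b; have [x ->] := sep_piP q; rewrite !sep_scaleE scalerDl raddfD.
Qed.

HB.instance Definition _ := GRing.Zmodule_isLmodule.Build R[i] sep_quot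
  sep_scaleA sep_scale1 sep_scaleDr sep_scaleDl.

Lemma sep_pi_scalable : scalable sep_pi.
Proof. by move=> a x; rewrite -sep_scaleE. Qed.
HB.instance Definition _ :=
  GRing.isScalable.Build R[i] V sep_quot *:%R sep_pi sep_pi_scalable.

Definition sep_inner (q r : sep_quot) : R[i] :=
  s (repr (q : Quotient.quot null_pred)) (repr (r : Quotient.quot null_pred)).

(** Representatives differ from x and y by null vectors, and null vectors are
    orthogonal to everything by the Cauchy-Schwarz inequality. *)
Lemma sep_innerE x y : sep_inner (sep_pi x) (sep_pi y) = s x y.
Proof.
rewrite /sep_inner; set x' := repr _; set y' := repr _.
have nul z : repr (sep_pi z : Quotient.quot null_pred) - z \in null_pred.
  by apply/sep_pi_eq; rewrite /sep_pi reprK.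
rewrite -(subrK x x') semi_innerDl semi_inner_null ?nul// add0r.
by rewrite sC -(subrK y y') semi_innerDl semi_inner_null ?nul// add0r -sC.
Qed.

Lemma sep_inner_lin a u v w :
  sep_inner (a *: u + v) w = a * sep_inner u w + sep_inner v w.
Proof.
have [x ->] := sep_piP u; have [y ->] := sep_piP v; have [z ->] := sep_piP w.
by rewrite -linearP !sep_innerE slin.
Qed.

Lemma sep_innerC u v : sep_inner u v = (sep_inner v u)^*.
Proof.
by have [x ->] := sep_piP u; have [y ->] := sep_piP v; rewrite !sep_innerE.
Qed.

Lemma sep_inner_gt0 u : u != 0 -> 0 < sep_inner u u.
Proof.
have [x ->] := sep_piP u; rewrite sep_innerE lt_def s_ge0 andbT.
by apply: contra => x0; rewrite -(raddf0 sep_pi); apply/eqP/sep_pi_eq; rewrite subr0.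
Qed.

Lemma sep_inner_bilinear :
  bilinear_for *%R (Num.conj \; *%R) sep_inner.
Proof.
split=> [w a u v|u a v w]; first exact: sep_inner_lin.
by rewrite sep_innerC sep_inner_lin rmorphD rmorphM /= -!sep_innerC.
Qed.

HB.instance Definition _ := bilinear_isBilinear.Build R[i] sep_quot sep_quot
  R[i] *%R (Num.conj \; *%R) sep_inner sep_inner_bilinear.


Lemma sep_inner_hermitian u v :
  sep_inner u v = (-1) ^+ false * Num.conj (sep_inner v u).
Proof. by rewrite expr0 mul1r -sep_innerC. Qed.

HB.instance Definition _ := isHermitianSesquilinear.Build R[i] sep_quot
  false Num.conj sep_inner sep_inner_hermitian.

HB.instance Definition _ :=
  isDotProduct.Build R[i] sep_quot sep_inner sep_inner_gt0.

Definition sep_norm (u : sep_quot) : R[i] := sqrtC (sep_inner u u).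

Lemma sep_normE u : sep_norm u ^+ 2 = sep_inner u u.
Proof. by rewrite sqrtCK. Qed.

Lemma sep_norm_ge0 u : 0 <= sep_norm u.
Proof. by have [x ->] := sep_piP u; rewrite sqrtC_ge0 sep_innerE s_ge0. Qed.

Lemma sep_CauchySchwarz u v : `|sep_inner u v| <= sep_norm u * sep_norm v.
Proof.
rewrite -(@ler_pXn2r _ 2)// ?nnegrE ?mulr_ge0 ?sep_norm_ge0//.
rewrite exprMn !sep_normE.
have [x ->] := sep_piP u; have [y ->] := sep_piP v.
by rewrite !sep_innerE semi_CauchySchwarz.
Qed.

Lemma sep_normD u v : sep_norm (u + v) <= sep_norm u + sep_norm v.
Proof.
rewrite -(@ler_pXn2r _ 2)// ?nnegrE ?addr_ge0 ?sep_norm_ge0//.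
rewrite sqrrD !sep_normE linearDl /= !linearDr /= -!addrA lerD2l.
rewrite (addrA (sep_inner u v)) [leRHS]addrA lerD2r (sep_innerC v u).
set z := sep_inner u v; have zr : z + z^* \is Num.real.
  by apply/CrealP; rewrite rmorphD /= conjCK addrC.
apply: le_trans (real_ler_norm zr) _; apply: le_trans (ler_normD _ _) _.
by rewrite norm_conjC lerD ?sep_CauchySchwarz.
Qed.

Lemma sep_normZ a u : sep_norm (a *: u) = `|a| * sep_norm u.
Proof.
apply: (@pexpIrn _ 2) => //; rewrite ?nnegrE ?mulr_ge0 ?sep_norm_ge0//.
by rewrite exprMn !sep_normE dnormZ.
Qed.

Lemma sep_norm_eq0 u : sep_norm u = 0 -> u = 0.
Proof. by move/eqP; rewrite sqrtC_eq0 dnorm_eq0 => /eqP. Qed.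

HB.instance Definition _ := Lmodule_isNormed.Build R[i] sep_quot
  sep_normD sep_normZ sep_norm_eq0.

Lemma sep_norm_inner (u : sep_quot) : `|u| ^+ 2 = sep_inner u u.
Proof. exact: sep_normE. Qed.

Hypothesis s_complete : semi_complete.

(** A Cauchy filter contains a ball of radius 1 / (k + 1) for every k; two such
    balls meet, so the centres form a Cauchy sequence, and the limit of their
    representatives supplied by [semi_complete] attracts the filter. *)
Lemma sep_complete (F : set_system sep_quot) :
  ProperFilter F -> cauchy F -> cvg F.
Proof.
move=> PF /cauchyP Fc.
pose e (k : nat) : R := k.+1%:R^-1.
have e_gt0 k : 0 < e k by rewrite invr_gt0 ltr0n.
have {Fc} /choice[x xF] : forall k, exists x, F (ball (sep_pi x) (e k)%:C%C).
  move=> k; have /Fc[q Fq] : 0 < (e k)%:C%C by rewrite ltcR.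
  by have [x qx] := sep_piP q; exists x; rewrite -qx.
have snormE y : complex.Re (s y y) = complex.Re (`|sep_pi y| ^+ 2).
  by rewrite sep_norm_inner sep_innerE.
have [k l kl|z zP] := s_complete (fun k => (e k *+ 2) ^+ 2) x.
  rewrite snormE Re_normX2.
  rewrite ltr_pXn2r ?nnegrE ?mulrn_wge0 ?Re_norm_ge0 ?(ltW (e_gt0 _))//.
  rewrite -ltcR -normr_Re linearB /=.
  have [q []] := filter_ex (filterI (xF k) (xF l)).
  rewrite -!ball_normE /= => kq lq.
  rewrite -(subrKA q); apply: le_lt_trans (ler_normD _ _) _.
  rewrite mulr2n rmorphD /= ltrD//; apply: lt_le_trans (_ : (e l)%:C%C <= _).
    by rewrite distrC.
  by rewrite lecR lef_pV2 ?posrE ?ltr0n// ler_nat.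
(* The limit is within 2 e k of the k-th centre, and the ball has radius e k. *)
apply/cvg_ex; exists (sep_pi z); apply/cvg_ballP => eps eps_gt0.
have epsE : eps = (complex.Re eps)%:C%C by rewrite RRe_real// gtr0_real.
have Reps : 0 < complex.Re eps by rewrite -ltcR -epsE.
have /filter_ex[k ke] : \forall k \near \oo, e k < complex.Re eps / 3.
  have e3 : 0 < complex.Re eps / 3 by rewrite divr_gt0.
  exact: (near_infty_natSinv_lt (PosNum e3)).
apply: filterS (xF k) => q; rewrite -!ball_normE /= => kq.
rewrite -(subrKA (sep_pi (x k))); apply: le_lt_trans (ler_normD _ _) _.
have : `|sep_pi z - sep_pi (x k)| <= (e k *+ 2)%:C%C.
  rewrite distrC -linearB normr_Re lecR.
  rewrite -(@ler_pXn2r _ 2)// ?nnegrE ?mulrn_wge0 ?Re_norm_ge0//;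
    last exact/ltW.
  by rewrite -Re_normX2 -snormE.
move=> /ler_ltD /(_ kq) /lt_trans; apply.
by rewrite -rmorphD /= epsE ltcR; lra.
Qed.

HB.instance Definition _ := Uniform_isComplete.Build sep_quot sep_complete.

HB.instance Definition _ :=
  CompleteNormedModule_isHilbert.Build R sep_quot sep_norm_inner.

Theorem semi_inner_Hilbert : exists (K : hilbertType R) (p : {linear V -> K}),
  forall x y, inner (p x) (p y) = s x y.
Proof. by exists sep_quot, sep_pi; exact: sep_innerE. Qed.

End SemiInnerProduct.

(** * Norm and inner product of a Hilbert space *)

Section HilbertNorm.
Context {R : realType} {H : hilbertType R}.
Implicit Types x y : H.

Lemma normE x : `|x| = (hnorm x)%:C%C.
Proof. exact: normr_Re. Qed.

Lemma hnorm_ge0 x : 0 <= hnorm x.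
Proof. exact: Re_norm_ge0. Qed.

Lemma hnormD x y : hnorm (x + y) <= hnorm x + hnorm y.
Proof. by rewrite -lecR rmorphD /= -!normE ler_normD. Qed.

Lemma hnormN x : hnorm (- x) = hnorm x.
Proof. by rewrite /hnorm normrN. Qed.

Lemma hnormZ a x : hnorm (a *: x) = complex.Re `|a| * hnorm x.
Proof.
by apply: complexI; rewrite -normE normrZ normE rmorphM /= RRe_real.
Qed.

Lemma inner_sqr x : inner x x = (hnorm x ^+ 2)%:C%C.
Proof. by rewrite -norm_inner normE rmorphXn. Qed.

Lemma inner_semi_inner : semi_inner (@inner R H).
Proof.
split=> [a x y z|x y|x]; last by rewrite -norm_inner exprn_ge0.
  by rewrite linearDl /= linearZl_LR.
by rewrite hermC expr0 mul1r.
Qed.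

Lemma inner_CauchySchwarz x y : `|inner x y| <= (hnorm x * hnorm y)%:C%C.
Proof.
have nn : 0 <= (hnorm x * hnorm y)%:C%C by rewrite ler0c mulr_ge0 ?hnorm_ge0.
rewrite -(@ler_pXn2r _ 2)// rmorphM /= exprMn -!normE !norm_inner.
exact/semi_CauchySchwarz/inner_semi_inner.
Qed.

End HilbertNorm.

(** * Limits along an ultrafilter *)

Section UltraLimit.
Context {R : realType} {U : set_system nat} {UU : UltraFilter U}.

(** By compactness u clusters at some p along U; an ultrafilter that meets every
    neighbourhood of p contains every neighbourhood of p. *)
Lemma ultra_bounded_cvg (u : nat -> R) (M : R) :
  (forall n, `|u n| <= M) -> cvg (u @ U).
Proof.
move=> uM; have uMM : (u @ U) `[- M, M]%classic.
  by apply: (@filterE _ U) => n; rewrite /= in_itv /= -ler_norml.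
have [p [_ clp]] := @segment_compact R (- M) M (u @ U) _ uMM.
apply/cvg_ex; exists p => B Bp.
have [//|nB] := in_ultra_setVsetC (u @^-1` B) UU.
by have [x []] := clp (~` B) B nB Bp.
Qed.

(** Convergence of complex sequences is taken coordinatewise, so that it follows
    from the compactness of real segments. *)
Definition ccvg (u : nat -> R[i]) (c : R[i]) :=
  complex.Re (u n) @[n --> U] --> complex.Re c /\
  complex.Im (u n) @[n --> U] --> complex.Im c.

Definition clim (u : nat -> R[i]) : R[i] :=
  (lim (complex.Re (u n) @[n --> U]) +i* lim (complex.Im (u n) @[n --> U]))%C.

Lemma ccvg_clim u (M : R) : (forall n, `|u n| <= M%:C%C) -> ccvg u (clim u).
Proof.
move=> uM; suff [uR uI] : (forall n, `|complex.Re (u n)| <= M) /\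
    (forall n, `|complex.Im (u n)| <= M).
  by split; [exact: ultra_bounded_cvg uR|exact: ultra_bounded_cvg uI].
split=> n; rewrite -lecR (le_trans _ (uM n))// normc_def lecR -sqrtr_sqr;
  by rewrite ler_wsqrtr// ?lerDl ?lerDr sqr_ge0.
Qed.

Lemma ccvg_lim u c : ccvg u c -> clim u = c.
Proof.
by case: c => a b [uR uI]; congr (_ +i* _)%C; [exact: cvg_lim uR|exact: cvg_lim uI].
Qed.

Lemma ccvg_lin a u v b c : ccvg u b -> ccvg v c ->
  ccvg (fun n => a * u n + v n) (a * b + c).
Proof.
move=> [uR uI] [vR vI].
have ReE (x y : R[i]) : complex.Re (a * x + y) =
    complex.Re a * complex.Re x - complex.Im a * complex.Im x + complex.Re y.
  by case: (a) x y => [? ?] [? ?] [? ?].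
have ImE (x y : R[i]) : complex.Im (a * x + y) =
    complex.Re a * complex.Im x + complex.Im a * complex.Re x + complex.Im y.
  by case: (a) x y => [? ?] [? ?] [? ?].
split; [rewrite ReE|rewrite ImE]; (under eq_fun do rewrite ?ReE ?ImE).
  by apply: cvgD vR; apply: cvgB; exact: cvgMl_tmp.
by apply: cvgD vI; apply: cvgD; exact: cvgMl_tmp.
Qed.

Lemma ccvg_conj u c : ccvg u c -> ccvg (fun n => (u n)^*) c^*.
Proof.
have ReE (x : R[i]) : complex.Re x^* = complex.Re x by case: x.
have ImE (x : R[i]) : complex.Im x^* = - complex.Im x by case: x.
move=> [uR uI]; split; [rewrite ReE|rewrite ImE]; under eq_fun do rewrite ?ReE ?ImE.
  by [].
exact: cvgN.
Qed.

Lemma ccvg_real (u : nat -> R) (l : R) :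
  u n @[n --> U] --> l -> ccvg (fun n => (u n)%:C%C) l%:C%C.
Proof. by move=> ul; split=> //=; exact: cvg_cst. Qed.

End UltraLimit.

(** * The ultraproduct of a sequence of Hilbert spaces *)

Section Ultraproduct.
Context {R : realType} (K_ : nat -> hilbertType R).
Context (U : set_system nat) {UU : UltraFilter U}.

Record bounded_seq := BoundedSeq {
  bseq :> forall n, K_ n;
  bseq_bounded : exists M : R, forall n, hnorm (bseq n) <= M }.
Implicit Types x y z : bounded_seq.

HB.instance Definition _ := gen_eqMixin bounded_seq.
HB.instance Definition _ := gen_choiceMixin bounded_seq.

Lemma bseqP x y : (forall n, x n = y n) -> x = y.
Proof.
case: x y => [x xb] [y yb] /= xy.
have {}xy : x = y by exact: functional_extensionality_dep.
by subst y; congr (BoundedSeq _ _); exact: Prop_irrelevance.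
Qed.

Lemma bseq0_bounded : exists M : R, forall n, hnorm (0 : K_ n) <= M.
Proof. by exists 0 => n; rewrite /hnorm normr0. Qed.

Lemma bseqD_bounded x y : exists M : R, forall n, hnorm (x n + y n) <= M.
Proof.
have [M xM] := bseq_bounded x; have [N yN] := bseq_bounded y.
by exists (M + N) => n; rewrite (le_trans (hnormD _ _))// lerD.
Qed.

Lemma bseqN_bounded x : exists M : R, forall n, hnorm (- x n) <= M.
Proof. by have [M xM] := bseq_bounded x; exists M => n; rewrite hnormN. Qed.

Lemma bseqZ_bounded a x : exists M : R, forall n, hnorm (a *: x n) <= M.
Proof.
have [M xM] := bseq_bounded x; exists (complex.Re `|a| * M) => n.
by rewrite hnormZ ler_wpM2l// -ler0c RRe_real.
Qed.

Definition bseq_zero := BoundedSeq (fun=> 0) bseq0_bounded.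
Definition bseq_add x y := BoundedSeq _ (bseqD_bounded x y).
Definition bseq_opp x := BoundedSeq _ (bseqN_bounded x).
Definition bseq_scale a x := BoundedSeq _ (bseqZ_bounded a x).

Lemma bseq_addA : associative bseq_add.
Proof. by move=> x y z; apply: bseqP => n; exact: addrA. Qed.

Lemma bseq_addC : commutative bseq_add.
Proof. by move=> x y; apply: bseqP => n; exact: addrC. Qed.

Lemma bseq_add0 : left_id bseq_zero bseq_add.
Proof. by move=> x; apply: bseqP => n; exact: add0r. Qed.

Lemma bseq_addN : left_inverse bseq_zero bseq_opp bseq_add.
Proof. by move=> x; apply: bseqP => n; exact: addNr. Qed.

HB.instance Definition _ := GRing.isZmodule.Build bounded_seq
  bseq_addA bseq_addC bseq_add0 bseq_addN.

Lemma bseq_scaleA a b x : bseq_scale a (bseq_scale b x) = bseq_scale (a * b) x.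
Proof. by apply: bseqP => n; exact: scalerA. Qed.

Lemma bseq_scale1 : left_id 1 bseq_scale.
Proof. by move=> x; apply: bseqP => n; exact: scale1r. Qed.

Lemma bseq_scaleDr : right_distributive bseq_scale +%R.
Proof. by move=> a x y; apply: bseqP => n; exact: scalerDr. Qed.

Lemma bseq_scaleDl x : {morph bseq_scale^~ x : a b / a + b}.
Proof. by move=> a b; apply: bseqP => n; exact: scalerDl. Qed.

HB.instance Definition _ := GRing.Zmodule_isLmodule.Build R[i] bounded_seq
  bseq_scaleA bseq_scale1 bseq_scaleDr bseq_scaleDl.

Definition ultra_inner x y : R[i] := clim (U := U) (fun n => inner (x n) (y n)).

Lemma ultra_inner_cvg x y :
  ccvg (U := U) (fun n => inner (x n) (y n)) (ultra_inner x y).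
Proof.
have [M xM] := bseq_bounded x; have [N yN] := bseq_bounded y.
apply: (@ccvg_clim _ _ _ _ (M * N)) => n.
by rewrite (le_trans (inner_CauchySchwarz _ _))// lecR ler_pM ?hnorm_ge0.
Qed.

Lemma ultra_inner_sqr x :
  hnorm (x n) ^+ 2 @[n --> U] --> complex.Re (ultra_inner x x).
Proof.
have [+ _] := ultra_inner_cvg x x.
by under eq_fun do rewrite inner_sqr.
Qed.

Lemma ultra_innerP : semi_inner ultra_inner.
Proof.
split=> [a x y z|x y|x].
- apply: ccvg_lim; under eq_fun do rewrite linearDl /= linearZl_LR.
  by apply: ccvg_lin; exact: ultra_inner_cvg.
- apply: ccvg_lim; under eq_fun do rewrite hermC expr0 mul1r.
  exact/ccvg_conj/ultra_inner_cvg.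
- have -> : ultra_inner x x = (complex.Re (ultra_inner x x))%:C%C.
    apply: ccvg_lim; under eq_fun do rewrite inner_sqr.
    exact/ccvg_real/ultra_inner_sqr.
  rewrite ler0c -(cvg_lim _ (ultra_inner_sqr x))//.
  apply: limr_ge; first by apply/cvg_ex; eexists; exact: ultra_inner_sqr.
  by apply: filterE => n; exact: sqr_ge0.
Qed.

Hypothesis U_oo : \oo `<=` U.

(** Diagonal argument.  Call k good at the coordinate n if the Cauchy estimates
    between x_0, ..., x_k hold at n.  For each k, U-almost every n is good for k.
    The diagonal sequence z takes at n the value of x_k for the largest good
    k <= n; wherever k is good and k <= n, it is then as close to x_k as the
    later members of the sequence are. *)
Lemma ultra_inner_complete : semi_complete ultra_inner.
Proof.
move=> d x xd.
pose P k i j n := (i <= j <= k)%N -> hnorm (x i n - x j n) ^+ 2 < d i.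
pose good n (k : 'I_n.+1) := `[< forall i j, P k i j n >].
have d0 : 0 < d 0%N.
  by apply: le_lt_trans (xd 0%N 0%N _); rewrite // subrr semi_inner0l//; exact: ultra_innerP.
have good0 n : good n ord0.
  apply/asboolP => -[|i] [|j] /andP[] // _ _.
  by rewrite subrr /hnorm normr0 expr0n.
(* Since 0 is good everywhere, the maximum is attained at a good index. *)
pose kmax : forall n, 'I_n.+1 := fun m => [arg max_(k > ord0 | good m k) (k : nat)].
have kmaxP : forall n, good n (kmax n) /\ forall k, good n k -> (k <= kmax n)%N.
  by move=> n; rewrite /kmax; case: arg_maxnP => [|k gk kP]; [exact: good0|split].
pose z n := x (kmax n) n.
have z_bounded : exists M : R, forall n, hnorm (z n) <= M.
  have [M xM] := bseq_bounded (x 0%N); exists (M + (1 + d 0%N)) => n.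
  rewrite -(subrK (x 0%N n) (z n)) addrC (le_trans (hnormD _ _))// lerD//.
  have /asboolP/(_ 0%N (kmax n)) := (kmaxP n).1.
  move=> /(_ (leqnn _)); rewrite -opprB hnormN -/(z n).
  (* A bound without square roots: t ^+ 2 < d 0 gives t <= 1 + d 0. *)
  by move: (hnorm _) => t; nra.
exists (BoundedSeq z z_bounded) => k.
rewrite -(cvg_lim _ (ultra_inner_sqr _))//.
apply: limr_le; first by apply/cvg_ex; eexists; exact: ultra_inner_sqr.
have Uk : U [set n | (k <= n)%N] by apply: U_oo; exists k.
have UP : U [set n | forall i j, P k i j n].
  have : \forall n \near U, forall i : 'I_k.+1, forall j : 'I_k.+1, P k i j n.
    apply: filter_forall => i; apply: filter_forall => j.
    have [/andP[ij jk]|nij] := boolP (i <= j <= k)%N; last first.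
      by apply: filterE => n; rewrite /P (negbTE nij).
    have /cvgr_lt/(_ _ (xd i j ij)) := ultra_inner_sqr (x i - x j).
    by apply: filterS => n + _.
  apply: filterS => n h i j ijk; have /andP[ij jk] := ijk.
  have jk1 : (j < k.+1)%N := jk.
  have ik1 : (i < k.+1)%N := leq_ltn_trans ij jk1.
  exact: (h (Ordinal ik1) (Ordinal jk1) ijk).
apply: filterS (filterI Uk UP) => n [/= kn kP].
have kn1 : (k < n.+1)%N by [].
have kk : (k <= kmax n)%N by apply: ((kmaxP n).2 (Ordinal kn1)); exact/asboolP.
have /asboolP/(_ k (kmax n)) := (kmaxP n).1.
by rewrite /P kk leqnn => /(_ isT) /ltW.
Qed.

End Ultraproduct.

(** * Operators as graphs *)

Section Operators.
Context {R : realType} {H K : hilbertType R}.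
Implicit Types T : set (H * K).

Lemma operator_unique {T} (f : H) (g h : K) :
  linear_operator T -> T (f, g) -> T (f, h) -> g = h.
Proof.
move=> [[T0 Tlin] Tmul] fg fh; apply/eqP; rewrite -subr_eq0; apply/eqP.
suff : mulpart T (g - h) by rewrite Tmul.
have := Tlin (-1) _ _ fh fg; congr T; congr (_, _); rewrite /= scaleN1r.
  by rewrite addNr.
by rewrite addrC.
Qed.

Lemma value_unique {T} (f : H) (g : K) :
  linear_operator T -> T (f, g) -> value T f = g.
Proof. by move=> Top fg; apply: xget_unique => // h fh; exact: operator_unique Top fh fg. Qed.

End Operators.

(** The contractions are indexed by all pairs (m, n), with the zero map as the
    value for n < m: this gives every h in K_m an orbit in the whole product. *)
Lemma prec_c_maps (R : realType) (H : hilbertType R) (K_ : nat -> hilbertType R)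
    (T_ : forall n, set (H * K_ n)) :
  (forall m n, (m <= n)%N -> prec_c (T_ n) (T_ m)) ->
  exists C : forall m n, {linear K_ m -> K_ n},
    (forall m n, contractive (C m n)) /\
    (forall m n f h, (m <= n)%N -> T_ m (f, h) -> T_ n (f, C m n h)).
Proof.
move=> Tprec.
have ex m n : exists C : {linear K_ m -> K_ n},
    contractive C /\ ((m <= n)%N -> lcomp C (T_ m) `<=` T_ n).
  have [mn|nm] := boolP (m <= n)%N; last first.
    by exists \0 => //; split=> // x; rewrite /= normr0.
  by have [C [Cc CT]] := Tprec m n mn; exists C.
exists (fun m n => projT1 (cid (ex m n))); split=> [m n|m n f h mn fh].
  by case: cid => C [].
by case: cid => C /= [_ /(_ mn)]; apply; exists h.
Qed.

(** * The limit operator *)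

Theorem theorem10p3 (R : realType) (H : hilbertType R)
    (K_ : nat -> hilbertType R) (T_ : forall n : nat, set (H * K_ n))
    (T_op : forall n : nat, linear_operator (T_ n))
    (T_prec : forall m n : nat, (m <= n)%N -> prec_c (T_ n) (T_ m)) :
  exists (K : hilbertType R) (T : set (H * K)),
    [/\ linear_operator T,
        dom T = \bigcup_n dom (T_ n),
        forall n : nat, prec_c T (T_ n)
      & forall phi : H, dom T phi -> norm_decreases_to T_ T phi].
Proof.
have [U [UU ooU]] := @ultraFilterLemma nat \oo _.
have [C [Cle CT]] := prec_c_maps R H K_ T_ T_prec.
have [K [p pE]] := semi_inner_Hilbert (ultra_inner K_ U)
  (ultra_innerP K_ U) (ultra_inner_complete K_ U ooU).
have Cnorm m n h : hnorm (C m n h) <= hnorm h by rewrite -lecR -!normE; exact: Cle.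
have orbit_bounded m (h : K_ m) : exists M : R, forall n, hnorm (C m n h) <= M.
  by exists (hnorm h) => n; exact: Cnorm.
pose J m h := p (BoundedSeq _ _ (orbit_bounded m h)).
have J_linear m : linear (J m).
  by move=> a g h; rewrite -linearP; congr (p _); apply: bseqP => n /=; rewrite linearP.
have hnorm_J m h : hnorm (C m n h) ^+ 2 @[n --> U] --> hnorm (J m h) ^+ 2.
  have := ultra_inner_sqr K_ U (BoundedSeq _ _ (orbit_bounded m h)).
  by rewrite -pE inner_sqr; exact.
have J_coherent m n f g h : T_ m (f, g) -> T_ n (f, h) -> J m g = J n h.
  move=> fg fh; apply: subr0_eq; apply: normr0_eq0; rewrite normE.
  rewrite /J -linearB; set x := (_ - _).
  (* Both orbits consist of values of T_k at f as soon as k >= m, n. *)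
  have x0 : hnorm (x k) ^+ 2 @[k --> U] --> (0 : R).
    apply: cvg_near_cst; apply: ooU; exists (maxn m n) => // k /=.
    rewrite geq_max => /andP[mk nk].
    rewrite (operator_unique _ _ _ (T_op k) (CT _ _ _ _ mk fg) (CT _ _ _ _ nk fh)).
    by rewrite subrr /hnorm normr0 expr0n.
  have := cvg_lim (@norm_hausdorff _ _) x0.
  rewrite (cvg_lim _ (ultra_inner_sqr K_ U x))// -pE inner_sqr /= => /(_ _)/eqP.
  by rewrite sqrf_eq0 => /eqP ->.
pose JL m : {linear K_ m -> K} := HB.pack (J m) (GRing.isLinear.Build _ _ _ _ _ (J_linear m)).
pose T : set (H * K) := [set q | exists n h, T_ n (q.1, h) /\ q.2 = J n h].
have J0 n : J n 0 = 0 := linear0 (JL n).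
have Top : linear_operator T.
  split; [split|].
  - by exists 0%N, 0; split; [exact: (T_op 0%N).1.1|exact/esym/J0].
  - move=> a [f f'] [g g'] /= [m [h [/= fh ->]]] [n [k [/= gk ->]]].
    pose N := maxn m n; have mN : (m <= N)%N := leq_maxl _ _.
    have nN : (n <= N)%N := leq_maxr _ _.
    have fN := CT _ _ _ _ mN fh; have gN := CT _ _ _ _ nN gk.
    exists N, (a *: C m N h + C n N k); split; first exact: ((T_op N).1.2 a _ _ fN gN).
    by rewrite /= J_linear (J_coherent _ _ _ _ _ fh fN) (J_coherent _ _ _ _ _ gk gN).
  - apply/seteqP; split=> [f' [n [h [/= h0 ->]]]|f' ->] /=.
      have -> : h = 0 by apply: (operator_unique _ _ _ (T_op n) h0); exact: (T_op n).1.1.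
      exact: J0.
    by exists 0%N, 0; split; [exact: (T_op 0%N).1.1|exact/esym/J0].
exists K, T; split=> //.
- apply/seteqP; split=> [f [f' [n [h [/= fh _]]]]|f [n _ [h fh]]].
    by exists n => //; exists h.
  by exists (J n h), n, h.
- move=> n; exists (JL n); split=> [h|[f f'] [h fh /= ->]]; last by exists n, h.
  rewrite !normE lecR -(@ler_pXn2r _ 2) ?nnegrE ?hnorm_ge0//.
  rewrite -(cvg_lim _ (hnorm_J n h))//.
  apply: limr_le; first by apply/cvg_ex; eexists; exact: hnorm_J.
  by apply: filterE => k; rewrite ler_pXn2r ?nnegrE ?hnorm_ge0.
- move=> f [f' [m [h [/= fh _]]]].
  have valueC i j g : (i <= j)%N -> T_ i (f, g) -> value (T_ j) f = C i j g.
    by move=> ij fg; apply: (value_unique _ _ (T_op j)); exact: CT.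
  have decr i j : (i <= j)%N -> dom (T_ i) f -> dom (T_ j) f ->
      hnorm (value (T_ j) f) <= hnorm (value (T_ i) f).
    move=> ij [g fg] _; rewrite (valueC _ _ _ ij fg) (value_unique _ _ (T_op i) fg).
    exact: Cnorm.
  split=> //.
  have -> : value T f = J m h by apply: (value_unique _ _ Top); exists m, h.
  set u := (u in u @ \oo).
  have u_cvg : cvg (u @ \oo).
    apply: (@near_nonincreasing_is_cvgn _ _ 0).
      exists m => // i /= mi j ij.
      apply: decr => //; [exists (C m i h)|exists (C m j h)]; apply: CT => //.
      exact: leq_trans mi ij.
    by apply: filterE => n; exact: hnorm_ge0.
  have /cvg_ex[l ul] := u_cvg.
  suff -> : hnorm (J m h) = l by [].
  (* The squares of u have the limit l ^+ 2 along U as well, since U refines oo. *)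
  have uUl : u n ^+ 2 @[n --> U] --> l ^+ 2.
    by rewrite expr2; under eq_fun do rewrite expr2; apply: cvgM => A /ul/ooU.
  have uUJ : u n ^+ 2 @[n --> U] --> hnorm (J m h) ^+ 2.
    apply: cvg_trans (hnorm_J m h); apply: near_eq_cvg.
    by apply: ooU; exists m => // n mn; rewrite /u (valueC _ _ _ mn fh).
  have l_ge0 : 0 <= l.
    rewrite -(cvg_lim _ ul)//; apply: limr_ge => //.
    by apply: filterE => n; exact: hnorm_ge0.
  apply: (@pexpIrn _ 2) => //; rewrite ?nnegrE ?hnorm_ge0//.
  by rewrite -(cvg_lim _ uUl)// -(cvg_lim _ uUJ).
Qed.
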